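(* Let $G$ be a $k$-adjacency dimensional graph and let $k_1,k_2$ be integers with $1\le k_1<k_2\le k$. Then $\operatorname{adim}_{k_1}(G)<\operatorname{adim}_{k_2}(G)$.
   Context: All graphs are finite and simple (not necessarily connected). For a graph $G=(V,E)$, $d_{G,2}(x,y)=\min\{d_G(x,y),2\}$ where $d_G$ is the shortest-path distance ($\infty$ between different components). For distinct $x,y\in V$, $\mathcal{C}_G(x,y)=\{z\in V:\ d_{G,2}(x,z)\neq d_{G,2}(y,z)\}$. A set $S\subseteq V$ is a $k$-adjacency generator if $|S\cap\mathcal{C}_G(x,y)|\ge k$ for all distinct $x,y\in V$; a minimum one is a $k$-adjacency basis, of cardinality $\operatorname{adim}_k(G)$. $G$ is $k$-adjacency dimensional if $k$ is the largest integer for which a $k$-adjacency generator of $G$ exists. *)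

(* Defs.v *)
From mathcomp Require Import all_boot.

Set Implicit Arguments.
Unset Strict Implicit.
Unset Printing Implicit Defensive.

Record sgraph := SGraph {
  vertex :> finType;
  adj : rel vertex;
  adj_sym : symmetric adj;
  adj_irr : irreflexive adj
}.

Section AdjacencyDimension.

Variable G : sgraph.
Implicit Types (x y z : G) (S : {set G}) (k n : nat).

Definition walk x y n : bool :=
  [exists p : n.-tuple G, path (@adj G) x p && (last x p == y)].

Lemma connect_walk x y : connect (@adj G) x y -> exists n, walk x y n.
Proof.
case/connectP=> p xp ->; exists (size p).
by apply/existsP; exists (in_tuple p); rewrite /= xp eqxx.
Qed.

(* Shortest-path distance, where None stands for infinity; a walk of minimum
   length is a path. *)
Definition dist x y : option nat :=
  if @idP (connect (@adj G) x y) is ReflectT xy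
  then Some (ex_minn (connect_walk xy)) else None.

Definition dist2 x y : nat := if dist x y is Some d then minn d 2 else 2.

Definition distinguishers x y : {set G} := [set z | dist2 x z != dist2 y z].

Definition adj_generator k S : bool :=
  [forall x, forall y, (x != y) ==> (k <= #|S :&: distinguishers x y|)].

(* The minimum cardinality of a k-adjacency generator. If there is none, this
   evaluates to the default #|G|. *)
Definition adim k : nat :=
  #|[arg min_(S < [set: G] | adj_generator k S) #|S|]|.

Definition adj_dimensional k : Prop :=
  (exists S, adj_generator k S) /\
  (forall n, (exists S, adj_generator n S) -> n <= k).

Lemma sub_adj_generator k S S' :
  S \subset S' -> adj_generator k S -> adj_generator k S'.
Proof.
move=> sSS' /forallP gS; apply/forallP=> x; apply/forallP=> y.
apply/implyP=> xy; have /forallP/(_ y)/implyP/(_ xy) := gS x.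
by move/leq_trans; apply; apply: subset_leq_card; apply: setSI.
Qed.

(* The default of adim is not used as soon as a generator exists. *)
Lemma adimP k : (exists S, adj_generator k S) ->
  (exists2 S, adj_generator k S & #|S| = adim k) /\
  (forall S, adj_generator k S -> adim k <= #|S|).
Proof.
case=> S gS; have gT := sub_adj_generator (subsetT S) gS.
by rewrite /adim; case: arg_minnP => // B gB minB; split=> //; exists B.
Qed.

End AdjacencyDimension.

(* Main.v *)
(* Deleting one vertex from a k2-adjacency basis lowers each intersection
   |S :&: distinguishers x y| by at most one, so what remains is still a
   k1-adjacency generator. *)
Require Import Defs.
From mathcomp Require Import all_boot.

(** Removing a vertex from a [k2]-adjacency basis leaves a smaller [k1]-adjacency generator
    ([adj_generatorD1]). A vertex to remove exists: were the basis empty, no two vertices would be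
    distinct, so generators of every order would exist and no [k] would be largest
    ([adj_generator_neq0]). *)

Lemma adj_generatorP (G : sgraph) (k : nat) (S : {set G}) :
  reflect (forall x y : G, x != y -> k <= #|S :&: distinguishers x y|)
          (adj_generator k S).
Proof.
apply: (iffP forallP) => gS x; last by apply/forallP=> y; apply/implyP/gS.
by move=> y xy; have /forallP/(_ y)/implyP/(_ xy) := gS x.
Qed.

Lemma adj_generator_leq (G : sgraph) (m n : nat) (S : {set G}) :
  m <= n -> adj_generator n S -> adj_generator m S.
Proof.
move=> le_mn /adj_generatorP gS; apply/adj_generatorP=> x y xy.
exact: leq_trans le_mn (gS x y xy).
Qed.

Lemma adj_generatorD1 (G : sgraph) (n : nat) (S : {set G}) (z : G) :
  adj_generator n.+1 S -> adj_generator n (S :\ z).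
Proof.
move=> /adj_generatorP gS; apply/adj_generatorP=> x y xy.
have := gS x y xy; rewrite setIDAC (cardsD1 z (_ :&: _)).
by case: (z \in _) => // /ltnW.
Qed.

(* The empty set generates only when there is no pair of distinct vertices, and
   then it is an n-adjacency generator for every n. *)
Lemma adj_generator_neq0 (G : sgraph) (k n : nat) (S : {set G}) :
  adj_dimensional G k -> 0 < n -> adj_generator n S -> S != set0.
Proof.
move=> [_ maxk] n_gt0 /adj_generatorP gS; apply/eqP=> S0.
suff /maxk : exists S : {set G}, adj_generator k.+1 S by rewrite ltnn.
exists S; apply/adj_generatorP=> x y /gS.
by rewrite S0 set0I cards0 leqNgt n_gt0.
Qed.

Theorem theorem10 (G : sgraph) (k k1 k2 : nat) :
  adj_dimensional G k -> 1 <= k1 -> k1 < k2 -> k2 <= k ->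
  adim G k1 < adim G k2.
Proof.
move=> dimG _ lt_k12 le_k2k; have [[S0 gS0] _] := dimG.
(* As [k2 <= k], a [k2]-generator exists, so [adim G k2] is the size of a genuine basis [S], not the
   default. *)
have [|[S gS <-] _] := @adimP G k2.
  by exists S0; apply: adj_generator_leq gS0.
have /set0Pn[z Sz] : S != set0.
  by apply: adj_generator_neq0 dimG _ gS; apply: leq_ltn_trans lt_k12.
have gSz : adj_generator k1 (S :\ z).
  (* [k1 < k2] is [k1.+1 <= k2]: the spare unit pays for the loss of [z]. *)
  exact/adj_generatorD1/(adj_generator_leq _ _ _ _ lt_k12 gS).
have [|_ /(_ _ gSz)] := @adimP G k1; first by exists (S :\ z).
by rewrite (cardsD1 z S) Sz.
Qed.
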